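(* Let $\alpha>1$ and $w>0$, let $p_0\in\mathcal{P}_{\alpha,w}$, and let the sequence $(p_t)_{t\ge 0}$ be defined by $p_{t+1}=T[p_t]$ for $t=0,1,2,\dots$. Let $F_t(x)=\int_0^x p_t(u)\,du$ and $F_w^{*}(x)=\int_0^x p_w^{*}(u)\,du$, where $p_w^{*}(x)=\frac{1}{\sqrt{2w\pi x}}e^{-\frac{x}{2w}}$ for $x>0$. Then $$\lim_{t\to\infty}F_t(x)=F_w^{*}(x)\qquad\text{for all } x\ge 0.$$
   Context: $\mathcal{P}$ is the set of probability densities on $[0,\infty)$, i.e. a.e. non-negative functions $p\in L^1[0,\infty)$ with $\|p\|_{L^1}=1$. For real $\alpha\ge 0$, $M_\alpha(p)=\int_0^\infty x^\alpha p(x)\,dx$. For $\alpha\ge 1$ and $w>0$, $$\mathcal{P}_{\alpha,w}=\{p\in\mathcal{P}\;|\;M_\alpha(p)<\infty,\ M_1(p)=w\}.$$ For $p\in\mathcal{P}$, the operator $T$ is defined (for a.e. $x>0$) by $$T[p](x)=\frac{1}{2}\int_0^x p(x-u)\int_u^\infty \frac{1}{v}p(v)\,dv\,du+\frac{1}{2}\int_x^\infty \frac{1}{u}p(u)\,du .$$ *)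

(* Defs.v *)
From HB Require Import structures.
From mathcomp Require Import all_boot all_order all_algebra.
From mathcomp Require Import all_classical all_reals all_analysis.

Set Implicit Arguments.
Unset Strict Implicit.
Unset Printing Implicit Defensive.

Import Order.TTheory GRing.Theory Num.Theory.
Import numFieldNormedType.Exports.

Local Open Scope classical_set_scope.
Local Open Scope ring_scope.
Local Open Scope ereal_scope.

(* A density on [0, +oo) is represented by a function p : R -> R; its values
   outside [0, +oo) are never used. *)

Definition density (R : realType) (p : R -> R) : Prop :=
  [/\ (@lebesgue_measure R).-integrable `[0%R, +oo[ (fun x => (p x)%:E),
      {ae @lebesgue_measure R, forall x : R, (0 <= x)%R -> (0 <= p x)%R}
    & \int[@lebesgue_measure R]_(x in `[0%R, +oo[) `|(p x)%:E| = 1].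

Definition moment (R : realType) (alpha : R) (p : R -> R) : \bar R :=
  \int[@lebesgue_measure R]_(x in `[0%R, +oo[) (x `^ alpha * p x)%:E.

Definition density_class (R : realType) (alpha w : R) (p : R -> R) : Prop :=
  [/\ density p, moment alpha p < +oo & moment 1 p = w%:E].

(* The value is an extended real: for a density p, it may be infinite, but
   only for x in a null subset of (0, +oo). *)
Definition T_op (R : realType) (p : R -> R) (x : R) : \bar R :=
  (2^-1)%:E *
    \int[@lebesgue_measure R]_(u in `[0%R, x])
      ((p (x - u)%R)%:E *
       \int[@lebesgue_measure R]_(v in `[u, +oo[) (v^-1 * p v)%:E)
  + (2^-1)%:E * \int[@lebesgue_measure R]_(u in `[x, +oo[) (u^-1 * p u)%:E.

(* q is a (Borel) representative of the a.e.-class of f on [0, +oo);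
   measurability must be required of q because Borel measurability is not
   preserved by a.e. equality. *)
Definition represents (R : realType) (q : R -> R) (f : R -> \bar R) : Prop :=
  measurable_fun (`[0%R, +oo[ : set (measurableTypeR R)) q /\
  {ae @lebesgue_measure R, forall x : R, (0 < x)%R -> (q x)%:E = f x}.

Definition primitive0 (R : realType) (p : R -> R) (x : R) : \bar R :=
  \int[@lebesgue_measure R]_(u in `[0%R, x]) (p u)%:E.

(* At x = 0 the value is 0, since Num.sqrt 0 = 0 and 0^-1 = 0. *)
Definition pstar (R : realType) (w x : R) : R :=
  ((Num.sqrt (2 * w * pi * x))^-1 * expR (- (x / (2 * w))))%R.

(* Main.v *)
(* If X, V are independent with density p, U is uniform on [0, 1] and B is a
   fair coin, then T[p] is the density of B X + U V. Hence the Laplace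
   transforms L_t of p_t satisfy
     L_{t+1}(s) = (1 + L_t(s)) / 2 * \int_0^1 L_t(s r) dr,
   and Lambda(s) = (1 + 2 w s)^(-1/2), the transform of p*_w, is a fixed point.
   For 1 < a <= min(alpha, 2) the moment hypotheses give
   |L_0(s) - Lambda(s)| <= D s^a, because both transforms are
   1 - w s + O(s^a); the recursion then multiplies D by
   1/2 + 1/(a + 1) < 1 at each step, so L_t -> Lambda pointwise.
   Convergence of the distribution functions follows by integrating the test
   functions (1 - e^(- nu x))^m, which for m close to e^(nu c) approximate the
   indicator of x > c and whose integrals are combinations of values of L_t. *)
Require Import Defs.
From HB Require Import structures.
From mathcomp Require Import all_boot all_order all_algebra.
From mathcomp Require Import all_classical all_reals all_analysis.
From mathcomp Require Import measurable_realfun ring lra.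

Import Order.TTheory GRing.Theory Num.Theory.
Import numFieldNormedType.Exports.

Local Open Scope classical_set_scope.
Local Open Scope ring_scope.

Section RandomExchange.
Context {R : realType}.
Local Notation mu := (@lebesgue_measure R).

(** * Affine changes of variable in Lebesgue integrals *)

(** The pushforward of Lebesgue measure by the translation gives every half-open interval its
    length, and only Lebesgue measure does so. Reflection and dilation below follow the same
    pattern, with the pushforward rescaled by [c] in the case of dilation. *)
Lemma ge0_integral_shift (u : R) (h : R -> \bar R) :
  measurable_fun [set: R] h -> (forall x, 0 <= h x)%E ->
  (\int[mu]_x h (x - u)%R = \int[mu]_x h x)%E.
Proof.
move=> mh h0.
have mphi : measurable_fun setT ((fun x => x - u) : measurableTypeR R -> measurableTypeR R).
  exact: measurable_funB.
rewrite -[LHS](@ge0_integral_pushforward _ _ _ _ _ _ mphi mu setT h)//.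
apply: eq_measure_integral => //= A mA _.
apply/esym/lebesgue_measure_unique => //= _ [[a b]] _ <-.
rewrite /pushforward (_ : _ @^-1` _ = `]a + u, b + u]%classic); last first.
  by apply/seteqP; split => x /=; rewrite !in_itv/= ltrBrDr lerBlDr.
rewrite /= !lebesgue_measure_itv/= !lte_fin ltrD2r; case: ifP => // _.
by rewrite -!EFinB; congr EFin; ring.
Qed.

Lemma ge0_integral_reflect (u : R) (h : R -> \bar R) :
  measurable_fun [set: R] h -> (forall x, 0 <= h x)%E ->
  (\int[mu]_x h (u - x)%R = \int[mu]_x h x)%E.
Proof.
move=> mh h0.
have mphi : measurable_fun setT ((fun x => u - x) : measurableTypeR R -> measurableTypeR R).
  exact: measurable_funB.
rewrite -[LHS](@ge0_integral_pushforward _ _ _ _ _ _ mphi mu setT h)//.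
apply: eq_measure_integral => //= A mA _.
apply/esym/lebesgue_measure_unique => //= _ [[a b]] _ <-.
rewrite /pushforward (_ : _ @^-1` _ = `[u - b, u - a[%classic); last first.
  apply/seteqP; split => x /=; rewrite !in_itv/=; lra.
rewrite /= !lebesgue_measure_itv/= !lte_fin.
have -> : (u - b < u - a) = (a < b) by apply/idP/idP; lra.
case: ifP => // _.
by rewrite -!EFinB; congr EFin; ring.
Qed.

Lemma ge0_integral_dilate (c : R) (h : R -> \bar R) : 0 < c ->
  measurable_fun [set: R] h -> (forall x, 0 <= h x)%E ->
  (c%:E * \int[mu]_x h (c * x)%R = \int[mu]_x h x)%E.
Proof.
move=> c0 mh h0.
have mphi : measurable_fun setT ((fun x => c * x) : measurableTypeR R -> measurableTypeR R).
  exact: measurable_funM.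
rewrite -[X in (_ * X)%E](@ge0_integral_pushforward _ _ _ _ _ _ mphi mu setT h)//.
have c0' := ltW c0.
rewrite -(@ge0_integral_mscale _ _ _ (pushforward mu _) _ _ (NngNum c0'))//.
apply: eq_measure_integral => //= A mA _.
apply/esym/lebesgue_measure_unique => //= _ [[a b]] _ <-.
rewrite /mscale/= /pushforward (_ : _ @^-1` _ = `]a / c, b / c]%classic); last first.
  by apply/seteqP; split => x /=; rewrite !in_itv/= ler_pdivlMr// ltr_pdivrMr// mulrC.
rewrite /= !lebesgue_measure_itv/= !lte_fin ltr_pM2r ?invr_gt0//; case: ifP => _; rewrite ?mule0//.
by rewrite -!EFinB -EFinM; congr EFin; field; rewrite gt_eqF.
Qed.

Lemma measurable_invr : measurable_fun [set: R] (@GRing.inv R).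
Proof.
rewrite (_ : [set: R] = [set 0] `|` ~` [set 0]); last by rewrite setUv.
apply/measurable_funU => //; first exact: measurableC.
split; first exact: measurable_fun_set1.
apply: open_continuous_measurable_fun; first exact/closed_openC.
by move=> x /set_mem/= /eqP x0; exact: inv_continuous.
Qed.

(** * Laplace transforms and convolutions with extended real values *)

(** Extended values let Tonelli's theorem apply to nonnegative functions without any integrability
    condition. The integral runs over the whole line because the densities concerned vanish at
    negative arguments. *)
Definition elaplace (h : R -> \bar R) (s : R) : \bar R :=
  (\int[mu]_x ((expR (- (s * x)))%:E * h x))%E.

Definition econv (h k : R -> \bar R) (x : R) : \bar R :=
  (\int[mu]_u (h (x - u)%R * k u))%E.

Lemma measurable_expRNM (s : R) : measurable_fun [set: R] (fun x => expR (- (s * x))).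
Proof.
by apply: measurableT_comp => //; apply: measurableT_comp => //; exact: measurable_funM.
Qed.

Lemma elaplace_ge0 (h : R -> \bar R) s : (forall x, 0 <= h x)%E -> (0 <= elaplace h s)%E.
Proof. by move=> h0; apply: integral_ge0 => x _; rewrite mule_ge0// lee_fin expR_ge0. Qed.

Lemma measurable_econv_kernel (h k : R -> \bar R) :
  measurable_fun [set: R] h -> measurable_fun [set: R] k ->
  measurable_fun [set: R * R] (fun z => h (z.1 - z.2)%R * k z.2)%E.
Proof.
move=> mh mk; apply: emeasurable_funM.
  by apply: measurableT_comp => //; exact: measurable_funB.
exact: measurableT_comp.
Qed.

Lemma measurable_econv (h k : R -> \bar R) :
  measurable_fun [set: R] h -> (forall x, 0 <= h x)%E ->
  measurable_fun [set: R] k -> (forall x, 0 <= k x)%E ->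
  measurable_fun [set: R] (econv h k).
Proof.
move=> mh h0 mk k0.
apply: (measurable_fun_fubini_tonelli_F (m2 := mu) (fun z : R * R => h (z.1 - z.2)%R * k z.2)%E).
  exact: measurable_econv_kernel.
by move=> z; exact: mule_ge0.
Qed.

(** Tonelli exchanges the two integrals; then e^(-s x) = e^(-s (x - u)) e^(-s u), and translation
    invariance separates the factors. *)
Lemma elaplace_econv (h k : R -> \bar R) (s : R) :
  measurable_fun [set: R] h -> (forall x, 0 <= h x)%E ->
  measurable_fun [set: R] k -> (forall x, 0 <= k x)%E ->
  (elaplace (econv h k) s = elaplace h s * elaplace k s)%E.
Proof.
move=> mh h0 mk k0.
have E0 x : (0 <= (expR (- (s * x)))%:E)%E by rewrite lee_fin expR_ge0.
transitivity (\int[mu]_x \int[mu]_u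
    ((expR (- (s * x)))%:E * (h (x - u)%R * k u)))%E.
  apply: eq_integral => x _; rewrite -ge0_integralZl//.
  - apply: emeasurable_funM => //; apply: measurableT_comp => //.
    exact: measurable_funB.
  - by move=> u _; exact: mule_ge0.
rewrite (fubini_tonelli (m1 := mu) (m2 := mu)
  (fun z : R * R => (expR (- (s * z.1)))%:E * (h (z.1 - z.2)%R * k z.2))%E)/=; first last.
- by move=> z; rewrite !mule_ge0.
- apply: emeasurable_funM; last exact: measurable_econv_kernel.
  apply: measurableT_comp => //.
  exact: (measurableT_comp (measurable_expRNM s)).
transitivity (\int[mu]_u (elaplace h s * ((expR (- (s * u)))%:E * k u)))%E.
  apply: eq_integral => u _.
  rewrite [in RHS]/elaplace -(@ge0_integral_shift u (fun x => (expR (- (s * x)))%:E * h x)%E); last 2 first.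
  - apply: emeasurable_funM => //; apply/measurable_EFinP; exact: measurable_expRNM.
  - by move=> x; rewrite mule_ge0.
  rewrite -ge0_integralZr//; first last.
  - by rewrite mule_ge0.
  - by move=> x _; rewrite mule_ge0.
  - apply: emeasurable_funM.
      apply/measurable_EFinP; apply: (measurableT_comp (measurable_expRNM s)).
      exact: measurable_funB.
    by apply: measurableT_comp => //; exact: measurable_funB.
  apply: eq_integral => x _ /=.
  by rewrite [RHS]muleACA -EFinM -expRD; congr ((expR _)%:E * _)%E; ring.
rewrite ge0_integralZl//.
- apply: emeasurable_funM => //; apply/measurable_EFinP; exact: measurable_expRNM.
- by move=> x _; rewrite mule_ge0.
- exact: elaplace_ge0.
Qed.

(** * Densities on the half-line and the law of U V *)

(* Vanishing at 0 too keeps the junk value 0^-1 = 0 from mattering in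
   [tail_kernel]. *)
Definition pdensity (f : R -> R) : Prop :=
  [/\ measurable_fun [set: R] f, forall x, 0 <= f x,
      forall x, x <= 0 -> f x = 0 & (\int[mu]_x (f x)%:E = 1)%E].

Definition tail_kernel (f : R -> R) (u v : R) : \bar R :=
  if (0 <= u) && (u <= v) then (v^-1 * f v)%:E else 0%E.

(* The density of U V when V has density f and U is uniform on [0, 1]. *)
Definition tail (f : R -> R) (u : R) : \bar R := (\int[mu]_v tail_kernel f u v)%E.

Lemma tailE (f : R -> R) (u : R) : 0 <= u ->
  tail f u = (\int[mu]_(v in `[u, +oo[) (v^-1 * f v)%:E)%E.
Proof.
move=> u0; rewrite [RHS]integral_mkcond; apply: eq_integral => v _.
by rewrite patchE /tail_kernel u0/= mem_setE in_itv/= andbT.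
Qed.

Lemma tail_lt0 (f : R -> R) (u : R) : u < 0 -> tail f u = 0%E.
Proof.
by move=> u0; rewrite /tail integral0_eq// => v _; rewrite /tail_kernel leNgt u0.
Qed.

Lemma tail_kernel_ge0 f u v : pdensity f -> (0 <= tail_kernel f u v)%E.
Proof.
move=> [_ f0 _ _]; rewrite /tail_kernel; case: ifPn => // /andP[u0 uv].
by rewrite lee_fin mulr_ge0// invr_ge0 (le_trans u0).
Qed.

Lemma measurable_tail_kernel f : pdensity f ->
  measurable_fun [set: R * R] (fun z => tail_kernel f z.1 z.2).
Proof.
move=> [mf _ _ _]; apply: measurable_fun_ifT => //.
  by apply: measurable_and; exact: measurable_fun_ler.
apply/measurable_EFinP; apply: measurable_funM; last exact: measurableT_comp.
exact: (measurableT_comp measurable_invr).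
Qed.

Lemma tail_ge0 f u : pdensity f -> (0 <= tail f u)%E.
Proof. by move=> df; apply: integral_ge0 => v _; exact: tail_kernel_ge0. Qed.

Lemma measurable_tail f : pdensity f -> measurable_fun [set: R] (tail f).
Proof.
move=> df; apply: (measurable_fun_fubini_tonelli_F (m2 := mu)
  (fun z : R * R => tail_kernel f z.1 z.2)).
  exact: measurable_tail_kernel.
by move=> z; exact: tail_kernel_ge0.
Qed.

Lemma measurable_tail_kernel1 f u : pdensity f -> measurable_fun [set: R] (tail_kernel f u).
Proof.
by move=> df; exact: (measurable_fun_pair2 u (measurable_tail_kernel _ df)).
Qed.

Lemma measurable_tail_kernel2 f v : pdensity f ->
  measurable_fun [set: R] (tail_kernel f ^~ v).
Proof.
by move=> df; exact: (measurable_fun_pair1 v (measurable_tail_kernel _ df)).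
Qed.

(** Tonelli brings the integral over u inside; for fixed v > 0 the substitution u = v r cancels the
    factor 1/v and turns 0 <= u <= v into 0 <= r <= 1; a second use of Tonelli moves r outside. *)
Lemma elaplace_tail (f : R -> R) (s : R) : pdensity f ->
  (elaplace (tail f) s =
   \int[mu]_(r in `[0%R, 1%R]) elaplace (EFin \o f) (s * r))%E.
Proof.
move=> df; have [mf f0 fneg _] := df.
have E0 x : (0 <= (expR x)%:E)%E by rewrite lee_fin expR_ge0.
transitivity (\int[mu]_u \int[mu]_v
    ((expR (- (s * u)))%:E * tail_kernel f u v))%E.
  apply: eq_integral => u _; rewrite -ge0_integralZl//.
  - exact: measurable_tail_kernel1.
  - by move=> v _; exact: tail_kernel_ge0.
rewrite (fubini_tonelli (m1 := mu) (m2 := mu)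
  (fun z : R * R => (expR (- (s * z.1)))%:E * tail_kernel f z.1 z.2)%E)/=; first last.
- by move=> z; rewrite mule_ge0// tail_kernel_ge0.
- apply: emeasurable_funM; last exact: measurable_tail_kernel.
  by apply/measurable_EFinP; exact: (measurableT_comp (measurable_expRNM s)).
(* The integrand after u = v r, as a function of the pair (v, r). *)
pose k (z : R * R) := (if (0 <= z.2) && (z.2 <= 1)
  then (expR (- (s * z.2 * z.1)) * f z.1)%:E else 0%E).
transitivity (\int[mu]_v \int[mu]_r k (v, r))%E.
  apply: eq_integral => v _.
  (* For v <= 0 both inner integrals vanish with [f v]; the dilation used afterwards requires v >
     0. *)
  have [v0|v0] := leP v 0.
    rewrite !integral0_eq// => u _; rewrite /k/= ?fneg// ?mulr0 ?if_same//.
    by rewrite /tail_kernel fneg// mulr0 if_same mule0.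
  have mH : measurable_fun [set: R]
      (fun u => (expR (- (s * u)))%:E * tail_kernel f u v)%E.
    apply: emeasurable_funM; last exact: measurable_tail_kernel2.
    by apply/measurable_EFinP; exact: measurable_expRNM.
  rewrite -(ge0_integral_dilate v _ v0 mH); last first.
    by move=> u; rewrite mule_ge0// tail_kernel_ge0.
  rewrite -ge0_integralZl//; last 3 first.
  - have mv : measurable_fun [set: R] (fun r => v * r) by exact: measurable_funM.
    exact: measurableT_comp mH mv.
  - by move=> u _ /=; rewrite mule_ge0// tail_kernel_ge0.
  - by rewrite lee_fin ltW.
  apply: eq_integral => r _; rewrite /tail_kernel /k/=.
  rewrite pmulr_rge0// ger_pMr//; case: ifPn => _; last by rewrite !mule0.
  rewrite -!EFinM; congr EFin.
  have -> : s * r * v = s * (v * r) by ring.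
  by field; rewrite gt_eqF.
rewrite (fubini_tonelli (m1 := mu) (m2 := mu) k); first last.
- by move=> z; rewrite /k; case: ifP => // _; rewrite lee_fin mulr_ge0// expR_ge0.
- apply: measurable_fun_ifT => //.
    by apply: measurable_and; exact: measurable_fun_ler.
  apply/measurable_EFinP; apply: measurable_funM; last exact: measurableT_comp.
  apply: measurableT_comp => //; apply: measurableT_comp => //.
  apply: measurable_funM => //; exact: measurable_funM.
rewrite [RHS]integral_mkcond; apply: eq_integral => r _.
rewrite patchE mem_setE in_itv/=; case: ifPn => r01; last first.
  by rewrite integral0_eq// => v _; rewrite /k/= (negbTE r01).
by apply: eq_integral => v _; rewrite /k/= r01 EFinM.
Qed.

(** * Almost everywhere statements and representatives *)

Lemma ae_imply (P Q : R -> Prop) : (forall x, P x -> Q x) ->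
  {ae mu, forall x, P x} -> {ae mu, forall x, Q x}.
Proof. by move=> PQ; apply: filterS => //; exact: (ae_filter_ringOfSetsType mu). Qed.

Lemma ae_imply2 (P Q S : R -> Prop) : (forall x, P x -> Q x -> S x) ->
  {ae mu, forall x, P x} -> {ae mu, forall x, Q x} -> {ae mu, forall x, S x}.
Proof. by move=> PQ; apply: filterS2 => //; exact: (ae_filter_ringOfSetsType mu). Qed.

Lemma ae_neq0 : {ae mu, forall x : R, x != 0}.
Proof.
exists [set 0]; split => //; first exact: lebesgue_measure_set1.
by move=> x /= /negP; rewrite negbK => /eqP.
Qed.

Lemma ae_gt0_ge0 (P : R -> Prop) :
  {ae mu, forall x, 0 < x -> P x} -> {ae mu, forall x : R, 0 <= x -> P x}.
Proof.
move=> H; apply: ae_imply2 H ae_neq0 => x Px x0 x_ge0.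
by apply: Px; rewrite lt_neqAle eq_sym x0.
Qed.

(** Allows a function [f] that is nonnegative everywhere and zero outside (0, +oo) to stand for [p],
    whose sign is known only almost everywhere and whose values at negative arguments are arbitrary.
    Measurability of [p] is included because exchanging [p] and [f] under an integral requires it on
    both sides. *)
Definition represented (f p : R -> R) : Prop :=
  measurable_fun (`[0%R, +oo[ : set R) p /\
  {ae mu, forall x, 0 < x -> p x = f x}.

(** Serves the factor [p (x - u)] of the convolution. Integrating the indicator of a null set [N]
    shows that reflection preserves null sets. *)
Lemma ae_reflect (P : R -> Prop) (x : R) :
  {ae mu, forall y, P y} -> {ae mu, forall u : R, P (x - u)}.
Proof.
move=> [N [mN N0 sN]]; pose M := (fun u => x - u) @^-1` N.
have mM : measurable (M : set (measurableTypeR R)).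
  rewrite -[M]setTI.
  have : measurable_fun setT ((fun u => x - u) : measurableTypeR R -> measurableTypeR R).
    exact: measurable_funB.
  exact.
exists M; split => //; last by move=> u /= nP; apply: sN.
rewrite -[M]setIT -integral_indic//.
have := ge0_integral_reflect x (fun y => (\1_N y)%:E).
rewrite integral_indic// setIT => H; rewrite [LHS]H//.
  by rewrite integral_indic// setIT; exact: N0.
by apply/measurable_EFinP; exact: measurable_indic.
Qed.

Lemma represented_integral (f p : R -> R) (D : set R) (g : R -> R) :
  pdensity f -> represented f p -> measurable D -> D `<=` `[0%R, +oo[ ->
  measurable_fun [set: R] g ->
  (\int[mu]_(x in D) (g x * p x)%:E = \int[mu]_(x in D) (g x * f x)%:E)%E.
Proof.
move=> [mf _ _ _] [mp /ae_gt0_ge0 pf] mD D0 mg; apply: ae_eq_integral => //.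
- apply/measurable_EFinP; apply: measurable_funM; first exact: measurable_funTS.
  exact: measurable_funS mp.
- apply/measurable_EFinP; apply: measurable_funTS; exact: measurable_funM.
- apply: ae_imply pf => x H /D0/=; rewrite in_itv/= andbT => x0.
  by rewrite H.
Qed.

(** * The operator T on representatives and its Laplace transform *)

(** The mixture over the coin B: with probability 1/2 the density of X + U V, with probability 1/2
    that of U V. *)
Definition T_density (f : R -> R) (x : R) : \bar R :=
  ((2^-1)%:E * econv (EFin \o f) (tail f) x + (2^-1)%:E * tail f x)%E.

(** Equality holds at every x > 0, not just almost everywhere, since passing from [p] to [f] alters
    each integrand on a null set only. The restriction to [0, x] can then be dropped: [tail f]
    vanishes for u < 0 and [f (x - u)] for u >= x. *)
Lemma T_op_represented (f p : R -> R) (x : R) :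
  pdensity f -> represented f p -> 0 < x -> T_op p x = T_density f x.
Proof.
move=> df pf x0; have [mf f0 fneg _] := df.
have tE u : 0 <= u ->
    (\int[mu]_(v in `[u, +oo[) (v^-1 * p v)%:E = tail f u)%E.
  move=> u0; rewrite tailE//; apply: represented_integral => //.
    by move=> v /=; rewrite !in_itv/= !andbT; exact: le_trans.
  exact: measurable_invr.
rewrite /T_op /T_density tE ?(ltW x0)//; congr (_ * _ + _)%E.
transitivity (\int[mu]_(u in `[0%R, x]) ((f (x - u)%R)%:E * tail f u))%E; last first.
  rewrite integral_mkcond; apply: eq_integral => u _.
  rewrite patchE mem_setE in_itv/=; have [u0|u0] := leP 0 u => /=; last first.
    by rewrite tail_lt0// mule0.
  by case: leP => //= xu; rewrite fneg ?mul0e// subr_le0 ltW.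
have [mp /ae_gt0_ge0 pfae] := pf.
have mphi : measurable_fun setT ((fun u => x - u) : measurableTypeR R -> measurableTypeR R).
  exact: measurable_funB.
transitivity (\int[mu]_(u in `[0%R, x]) ((p (x - u)%R)%:E * tail f u))%E.
  apply: eq_integral => u; rewrite inE/= in_itv/= => /andP[u0 _].
  by rewrite tE.
apply: ae_eq_integral => //.
- apply: emeasurable_funM; last by apply: measurable_funTS; exact: measurable_tail.
  apply/measurable_EFinP.
  apply: (measurable_comp _ _ mp) => //; last exact: measurable_funTS.
  by move=> _ [u /= + <-]; rewrite !in_itv/= andbT subr_ge0 => /andP[].
- apply: measurable_funTS; apply: emeasurable_funM; last exact: measurable_tail.
  by apply/measurable_EFinP; exact: measurableT_comp.
- apply: ae_imply (ae_reflect _ x pfae) => u H /=; rewrite in_itv/= => /andP[_ ux].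
  by rewrite H// subr_ge0.
Qed.

Lemma measurable_T_density f : pdensity f -> measurable_fun [set: R] (T_density f).
Proof.
move=> df; have [mf f0 _ _] := df.
apply: emeasurable_funD; apply: measurable_funeM; last exact: measurable_tail.
apply: measurable_econv; first exact/measurable_EFinP.
- by move=> x; rewrite lee_fin.
- exact: measurable_tail.
- by move=> x; exact: tail_ge0.
Qed.

Lemma econv_ge0 (h k : R -> \bar R) x : (forall x, 0 <= h x)%E ->
  (forall x, 0 <= k x)%E -> (0 <= econv h k x)%E.
Proof. by move=> h0 k0; apply: integral_ge0 => u _; exact: mule_ge0. Qed.

Lemma T_density_ge0 f x : pdensity f -> (0 <= T_density f x)%E.
Proof.
move=> df; have [_ f0 _ _] := df.
have h2 : (0 <= (2^-1 : R)%:E)%E by rewrite lee_fin invr_ge0.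
rewrite adde_ge0// mule_ge0//; last exact: tail_ge0.
by apply: econv_ge0 => y; rewrite ?lee_fin//; exact: tail_ge0.
Qed.

(** The convolution contributes the product of the transforms; the summand 1 comes from the half of
    the mixture in which B = 0. *)
Lemma elaplace_T_density (f : R -> R) (s : R) : pdensity f ->
  (elaplace (T_density f) s = (2^-1)%:E *
    (elaplace (EFin \o f) s + 1) * elaplace (tail f) s)%E.
Proof.
move=> df; have [mf f0 _ _] := df.
have h2 : (0 <= (2^-1 : R)%:E)%E by rewrite lee_fin invr_ge0.
have ef0 x : (0 <= (EFin \o f) x)%E by rewrite lee_fin.
have mef : measurable_fun [set: R] (EFin \o f) by exact/measurable_EFinP.
have t0 x := tail_ge0 f x df.
have mt := measurable_tail f df.
have mc := measurable_econv _ _ mef ef0 mt t0.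
have c0 x := econv_ge0 _ _ x ef0 t0.
have mE : measurable_fun [set: R] (fun x => (expR (- (s * x)))%:E).
  by apply/measurable_EFinP; exact: measurable_expRNM.
have E0 x : (0 <= (expR x)%:E)%E by rewrite lee_fin expR_ge0.
have Lf0 := elaplace_ge0 _ s ef0; have Lt0 := elaplace_ge0 _ s t0.
rewrite -muleA ge0_muleDl// mul1e ge0_muleDr ?mule_ge0//.
transitivity (\int[mu]_x ((2^-1)%:E * ((expR (- (s * x)))%:E * econv (EFin \o f) (tail f) x) +
   (2^-1)%:E * ((expR (- (s * x)))%:E * tail f x)))%E.
  apply: eq_integral => x _; rewrite /T_density ge0_muleDr ?mule_ge0//.
  by rewrite muleCA; congr (_ + _)%E; rewrite muleCA.
rewrite ge0_integralD//; last 4 first.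
- by move=> x _; rewrite !mule_ge0.
- by apply: measurable_funeM; exact: emeasurable_funM.
- by move=> x _; rewrite !mule_ge0.
- by apply: measurable_funeM; exact: emeasurable_funM.
rewrite !ge0_integralZl//; last 4 first.
- exact: emeasurable_funM.
- by move=> x _; rewrite mule_ge0.
- exact: emeasurable_funM.
- by move=> x _; rewrite mule_ge0.
rewrite -/(elaplace _ s) -/(elaplace _ s) elaplace_econv//.
Qed.

(** * Real-valued Laplace transforms of densities *)

Definition laplace (f : R -> R) (s : R) : R := fine (elaplace (EFin \o f) s).

Definition mean_laplace (f : R -> R) (s : R) : R :=
  \int[mu]_(r in `[0, 1]) laplace f (s * r).

Lemma elaplace0 (h : R -> \bar R) : elaplace h 0 = (\int[mu]_x h x)%E.
Proof. by apply: eq_integral => x _; rewrite mul0r oppr0 expR0 mul1e. Qed.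

Lemma elaplace_le1 (f : R -> R) (s : R) : pdensity f -> 0 <= s ->
  (elaplace (EFin \o f) s <= 1)%E.
Proof.
move=> [mf f0 fneg f1] s0; rewrite -f1; apply: ge0_le_integral => //.
- by move=> x _; rewrite -EFinM lee_fin mulr_ge0// expR_ge0.
- apply/measurable_EFinP; apply: measurable_funM => //; exact: measurable_expRNM.
- exact/measurable_EFinP.
- move=> x _ /=; rewrite -EFinM lee_fin; have [x0|x0] := leP x 0.
    by rewrite fneg// mulr0.
  by rewrite ler_piMl// -expR0 ler_expR oppr_le0 mulr_ge0// ltW.
Qed.

Lemma elaplaceE (f : R -> R) (s : R) : pdensity f -> 0 <= s ->
  elaplace (EFin \o f) s = (laplace f s)%:E.
Proof.
move=> df s0; rewrite fineK// ge0_fin_numE.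
  by rewrite (le_lt_trans (elaplace_le1 _ _ df s0))// ltry.
by apply: elaplace_ge0 => x; have [_ f0 _ _] := df; rewrite lee_fin.
Qed.

Lemma laplace_ge0 (f : R -> R) (s : R) : pdensity f -> 0 <= laplace f s.
Proof.
by move=> [_ f0 _ _]; apply/fine_ge0/elaplace_ge0 => x; rewrite lee_fin.
Qed.

Lemma laplace_le1 (f : R -> R) (s : R) : pdensity f -> 0 <= s -> laplace f s <= 1.
Proof. by move=> df s0; rewrite -lee_fin -elaplaceE// elaplace_le1. Qed.

Lemma laplace0 (f : R -> R) : pdensity f -> laplace f 0 = 1.
Proof.
by move=> df; apply: EFin_inj; rewrite -elaplaceE// elaplace0; have [_ _ _ ->] := df.
Qed.

Lemma measurable_laplace (f : R -> R) : pdensity f -> measurable_fun [set: R] (laplace f).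
Proof.
move=> [mf f0 _ _]; apply: measurableT_comp => //.
apply: (measurable_fun_fubini_tonelli_F (m2 := mu)
  (fun z : R * R => (expR (- (z.1 * z.2)))%:E * (f z.2)%:E)%E).
  apply: emeasurable_funM; last by apply/measurable_EFinP; exact: measurableT_comp.
  apply/measurable_EFinP; apply: measurableT_comp => //; apply: measurableT_comp => //.
  exact: measurable_funM.
by move=> z; rewrite -EFinM lee_fin mulr_ge0// expR_ge0.
Qed.

Lemma integrable_bounded01 (g : R -> R) (M : R) :
  measurable_fun [set: R] g -> (forall r, 0 <= r <= 1 -> `|g r| <= M) ->
  mu.-integrable `[0, 1] (EFin \o g).
Proof.
move=> mg gM; apply: measurable_bounded_integrable => //.
- by rewrite /= lebesgue_measure_itv/= lte01 oppr0 adde0 ltry.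
- exact: measurable_funTS.
- exists M; split; first exact: num_real.
  by move=> N MN r /=; rewrite in_itv/= => /gM /le_trans; apply; exact: ltW.
Qed.

Lemma integrable_laplace (f : R -> R) (s : R) : pdensity f -> 0 <= s ->
  mu.-integrable `[0, 1] (EFin \o (fun r => laplace f (s * r))).
Proof.
move=> df s0; apply: (integrable_bounded01 _ 1).
  apply: (measurableT_comp (measurable_laplace _ df)); exact: measurable_funM.
move=> r /andP[r0 r1]; rewrite ger0_norm ?laplace_ge0// laplace_le1//.
exact: mulr_ge0.
Qed.

Lemma elaplace_tailE (f : R -> R) (s : R) : pdensity f -> 0 <= s ->
  elaplace (tail f) s = (mean_laplace f s)%:E.
Proof.
move=> df s0; rewrite elaplace_tail// /mean_laplace /Rintegral fineK; last first.
  by apply: integrable_fin_num => //; exact: integrable_laplace.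
apply: eq_integral => r; rewrite inE/= in_itv/= => /andP[r0 _].
by rewrite elaplaceE// mulr_ge0.
Qed.

(** * Existence of representatives and one step of the recursion *)

(** The positive part of [p], cut off to (0, +oo), differs from [p] on only a null subset of the
    half-line. *)
Lemma positive_part_represented (p : R -> R) :
  measurable_fun (`[0%R, +oo[ : set R) p ->
  {ae mu, forall x, 0 < x -> 0 <= p x} ->
  exists f : R -> R, [/\ measurable_fun [set: R] f, forall x, 0 <= f x,
    forall x, x <= 0 -> f x = 0 & represented f p].
Proof.
move=> mp p0; pose f x := if 0 < x then Num.max (p x) 0 else 0.
exists f; split.
- rewrite (_ : f = (p \max cst 0) \_ `]0, +oo[).
    apply/(measurable_restrictT _ _).1 => //.
    apply: measurable_maxr => //; apply: measurable_funS mp => //.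
    by move=> x /=; rewrite !in_itv/= !andbT => /ltW.
  by apply/funext => x; rewrite patchE mem_setE in_itv/= andbT.
- by move=> x; rewrite /f; case: ifP => // _; rewrite le_max lexx orbT.
- by move=> x x0; rewrite /f ltNge x0.
- split => //; apply: ae_imply p0 => x H x0.
  by rewrite /f x0; apply/esym/max_idPl; exact: H.
Qed.

Lemma T_op_step (f p q : R -> R) : pdensity f -> represented f p ->
  represents q (T_op p) ->
  exists g, [/\ pdensity g, represented g q & forall s, 0 <= s ->
    laplace g s = 2^-1 * (laplace f s + 1) * mean_laplace f s].
Proof.
move=> df pf [mq qT].
have [mf f0 fneg _] := df.
have qT' : {ae mu, forall x, 0 < x -> (q x)%:E = T_density f x}.
  by apply: ae_imply qT => x H x0; rewrite H// (T_op_represented f).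
have q0 : {ae mu, forall x, 0 < x -> 0 <= q x}.
  by apply: ae_imply qT' => x H x0; rewrite -lee_fin H// T_density_ge0.
have [g [mg g0 gneg qg]] := positive_part_represented q mq q0.
have Lg s : 0 <= s -> elaplace (EFin \o g) s =
    (2^-1 * (laplace f s + 1) * mean_laplace f s)%:E.
  move=> s0; rewrite !EFinM EFinD -elaplaceE// -elaplace_tailE//.
  rewrite -elaplace_T_density//; apply: ae_eq_integral => //.
  - apply/measurable_EFinP; apply: measurable_funM => //; exact: measurable_expRNM.
  - apply: emeasurable_funM; last exact: measurable_T_density.
    by apply/measurable_EFinP; exact: measurable_expRNM.
  (* Agreement is needed on the whole line. The point 0 is null; for x < 0 the convolution is zero
     as well, because [tail f u] vanishes for u < 0 and [f (x - u)] for u >= 0. *)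
  - apply: (ae_imply2 (fun x => 0 < x -> (q x)%:E = T_density f x) (fun x => x != 0 /\ (0 < x -> q x = g x))).
    + move=> x H1 [xn0 H2] _ /=; congr (_ * _)%E.
      case: ltgtP xn0 => // [x0|x0] _; last by rewrite -H2// H1.
      rewrite gneg ?ltW// /T_density tail_lt0// mule0 adde0 /econv integral0_eq ?mule0// => u _.
      have [u0|u0] := ltP u 0; first by rewrite tail_lt0// mule0.
      by rewrite /= fneg ?mul0e// subr_le0 (le_trans (ltW x0)).
    + by [].
    + by apply: ae_imply2 ae_neq0 qg.2.
(* The total mass of [g] is its transform at 0, which the recursion evaluates to (1/2) (1 + 1) 1 =
   1. *)
have dg : pdensity g.
  split => //; rewrite -elaplace0 Lg// laplace0// /mean_laplace.
  under eq_Rintegral do rewrite mul0r laplace0//.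
  rewrite Rintegral_cst//= lebesgue_measure_itv/= lte01 oppr0 adde0/=.
  by congr EFin; lra.
exists g; split => // s s0; apply: EFin_inj; rewrite -elaplaceE// Lg//.
Qed.

Lemma density_represented (p : R -> R) : density p ->
  exists f, pdensity f /\ represented f p.
Proof.
move=> [ip p0 p1]; have mp := measurable_int _ ip.
move/measurable_EFinP in mp.
have [|f [mf f0 fneg pf]] := positive_part_represented p mp.
  by apply: ae_imply p0 => x H x0; exact/H/ltW.
exists f; split => //; split => //; rewrite -p1.
have [_ /ae_gt0_ge0 pfae] := pf.
rewrite -[LHS](_ : \int[mu]_(x in `[0%R, +oo[) (f x)%:E = _)%E.
  apply: ae_eq_integral => //.
  - by apply: measurable_funTS; exact/measurable_EFinP.
  - by apply: measurableT_comp => //; exact/measurable_EFinP.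
  - apply: ae_imply2 pfae p0 => x H1 H2 /=; rewrite in_itv/= andbT => x0.
    by rewrite ger0_norm ?H1// -H1// H2.
rewrite integral_mkcond; apply: eq_integral => x _.
rewrite patchE mem_setE in_itv/= andbT; case: leP => // /ltW x0.
by rewrite fneg.
Qed.

(** * The fixed point Lambda of the recursion *)

(** The source of the term 1/(a + 1) in the contraction factor. The endpoint 0 is treated by a right
    limit, as the derivative of [powR] is used only at positive arguments. *)
Lemma integral_powR01 (a : R) : 0 < a ->
  \int[mu]_(r in `[0, 1]) (r `^ a) = (a + 1)^-1 :> R.
Proof.
move=> a0; have a10 : a + 1 != 0 by rewrite gt_eqF// addr_gt0.
have cpow (b x : R) : 0 < x -> {for x, continuous (fun r : R => r `^ b)}.
  move=> x0; apply/differentiable_continuous/derivable1_diffP.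
  exact: (@ex_derive _ _ _ _ _ _ _ (is_derive1_powR b x0)).
have cright (b : R) : 0 < b -> (fun r : R => r `^ b) @ 0^'+ --> 0 `^ b.
  by move=> b0; rewrite powR0 ?gt_eqF//; exact: powR_cvg0.
rewrite /Rintegral.
rewrite (@continuous_FTC2 _ _ (fun r => (a + 1)^-1 * r `^ (a + 1)) 0 1)//=.
- rewrite powR1 powR0// mulr0 subr0 mulr1//.
- apply/continuous_within_itvP => //; split.
  + by move=> x; rewrite in_itv/= => /andP[x0 _]; exact: cpow.
  + exact: cright.
  + exact/cvg_at_left_filter/cpow.
- split.
  + move=> x; rewrite in_itv/= => /andP[x0 _].
    by have := is_derive1_powR (a + 1) x0.
  + by apply: cvgMr; apply: cright; rewrite addr_gt0.
  + by apply: cvgMr; exact/cvg_at_left_filter/cpow.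
- move=> x; rewrite in_itv/= => /andP[x0 _].
  have := is_derive1_powR (a + 1) x0 => d.
  rewrite derive1E derive_val addrK /GRing.scale/=.
  by rewrite mulrA mulVf// mul1r.
Qed.

Definition limit_laplace (w s : R) : R := (Num.sqrt (1 + 2 * w * s))^-1.

(** An antiderivative in r is sqrt(1 + 2 w s r) / (w s). With q = sqrt(1 + 2 w s) the mean is (q -
    1) / (w s) = 2 / (q + 1), and multiplying by (1/q + 1) / 2 gives 1/q. The division by w s is why
    s > 0 is assumed. *)
Lemma limit_laplace_fixpoint (w s : R) : 0 < w -> 0 < s ->
  limit_laplace w s = 2^-1 * (limit_laplace w s + 1) *
    \int[mu]_(r in `[0, 1]) limit_laplace w (s * r).
Proof.
move=> w0 s0; have ws0 : 0 < w * s by rewrite mulr_gt0.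
have pos (r : R) : 0 <= r -> 0 < 1 + 2 * w * (s * r).
  by move=> r0; rewrite ltr_wpDr// !mulr_ge0// ltW.
have dS (r : R) : 0 < 1 + 2 * w * (s * r) ->
    is_derive r 1 (Num.sqrt \o (fun r : R => 1 + 2 * w * (s * r)))
     ((2 * Num.sqrt (1 + 2 * w * (s * r)))^-1 * (2 * w * s)).
  move=> p; have d1 := is_derive1_sqrt p; apply: is_derive1_comp.
  by apply: is_derive_eq; rewrite /GRing.scale/=; ring.
have dF (r : R) : 0 <= r -> is_derive r 1
    (fun r => (w * s)^-1 * Num.sqrt (1 + 2 * w * (s * r))) (limit_laplace w (s * r)).
  move=> r0; have p := pos r r0; have d3 := dS r p.
  apply: is_derive_eq; rewrite /GRing.scale/= /limit_laplace.
  have q0 : Num.sqrt (1 + 2 * w * (s * r)) != 0 by rewrite gt_eqF// sqrtr_gt0.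
  by field; rewrite q0 !gt_eqF.
have dL (r : R) : 0 <= r -> derivable (fun r => limit_laplace w (s * r)) r 1.
  move=> r0; have p := pos r r0; have d3 := dS r p.
  apply: derivableV => //.
  by rewrite gt_eqF// sqrtr_gt0.
have cF (r : R) : 0 <= r ->
    {for r, continuous (fun r => (w * s)^-1 * Num.sqrt (1 + 2 * w * (s * r)))}.
  by move=> r0; have d := dF r r0; apply/differentiable_continuous/derivable1_diffP.
rewrite [X in _ = _ * X]/Rintegral.
rewrite (@continuous_FTC2 _ _ (fun r => (w * s)^-1 * Num.sqrt (1 + 2 * w * (s * r))) 0 1)//=.
- rewrite !mulr0 addr0 sqrtr1 mulr1 /limit_laplace mulr1.
  set q := Num.sqrt _.
  have q0 : 0 < q by rewrite sqrtr_gt0; have := pos 1 ler01; rewrite mulr1.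
  have qq : q ^+ 2 = 1 + 2 * w * s.
    by rewrite sqr_sqrtr//; have := ltW (pos 1 ler01); rewrite mulr1.
  have -> : 2^-1 * (q^-1 + 1) * ((w * s)^-1 * q - (w * s)^-1) =
     (q ^+ 2 - 1) / (2 * w * s) / q.
    by field; rewrite !gt_eqF.
  by rewrite qq; field; rewrite !gt_eqF.
- apply: derivable_within_continuous => r; rewrite in_itv/= => /andP[r0 _].
  exact: dL.
- split.
  + move=> r; rewrite in_itv/= => /andP[r0 _].
    by have := dF r (ltW r0).
  + exact/cvg_at_right_filter/cF.
  + exact/cvg_at_left_filter/cF.
- move=> r; rewrite in_itv/= => /andP[r0 _].
  by have d := dF r (ltW r0); rewrite derive1E derive_val.
Qed.

(** * First-order expansions at 0 with error of order s^a *)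

(** For y <= 1 the quadratic bound suffices because y^2 <= y^a; for y >= 1 the linear one does
    because y <= y^a. *)
Lemma le_powR_interpolate (a C y z : R) : 1 <= a <= 2 -> 1 <= C -> 0 <= y ->
  z <= y -> z <= C * y ^+ 2 -> z <= C * y `^ a.
Proof.
move=> /andP[a1 a2] C1 y0 zy zy2; have C0 : 0 <= C by lra.
move: y0; rewrite le_eqVlt => /predU1P[y0|y0].
  rewrite -y0 in zy2 zy *; rewrite expr0n/= mulr0 in zy2.
  by rewrite (le_trans zy2)// mulr_ge0// powR_ge0.
have [y1|/ltW y1] := leP y 1.
  apply: (le_trans zy2); rewrite ler_wpM2l// -powR_mulrn ?(ltW y0)//.
  by rewrite ger_powR// y0.
apply: (le_trans zy); apply: (le_trans (le1r_powR y1 a1)).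
by rewrite ler_peMl// powR_ge0.
Qed.

(** The linear bound is e^(-z) <= 1; the quadratic one follows from e^(-z) <= 1/(1 + z), which
    leaves z^2 / (1 + z). *)
Lemma expRN_taylor1_bound (a z : R) : 1 <= a <= 2 -> 0 <= z ->
  `|expR (- z) - 1 + z| <= z `^ a.
Proof.
move=> a12 z0; have e1 := expR_ge1Dx (- z).
rewrite ger0_norm; last lra.
rewrite -[leRHS]mul1r; apply: le_powR_interpolate => //.
  suff : expR (- z) <= 1 by lra.
  by rewrite -expR0 ler_expR oppr_le0.
rewrite mul1r expRN.
have z1 : 0 < 1 + z by lra.
have : (expR z)^-1 <= (1 + z)^-1 by rewrite lef_pV2 ?posrE ?expR_gt0// expR_ge1Dx.
suff : (1 + z)^-1 - 1 + z <= z ^+ 2 by lra.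
have -> : (1 + z)^-1 - 1 + z = z ^+ 2 / (1 + z) by field; rewrite gt_eqF.
by rewrite ler_pdivrMr// ler_peMr// ?sqr_ge0//; lra.
Qed.

Lemma limit_laplace_taylor1_bound (a w s : R) : 1 <= a <= 2 -> 0 < w -> 0 <= s ->
  `|limit_laplace w s - 1 + w * s| <= 2 * w `^ a * s `^ a.
Proof.
move=> a12 w0 s0; rewrite -mulrA -powRM ?(ltW w0)//.
have y0 : 0 <= w * s by rewrite mulr_ge0// ltW.
set y := w * s in y0 *.
rewrite /limit_laplace -mulrA -/y; set q := Num.sqrt _.
have q1 : 1 <= q by rewrite -sqrtr1 ler_wsqrtr//; lra.
have q0 : 0 < q by lra.
have qq : q ^+ 2 = 1 + 2 * y by rewrite sqr_sqrtr//; lra.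
have yE : y = (q ^+ 2 - 1) / 2 by lra.
have E : q^-1 - 1 + y = (q - 1) ^+ 2 * ((q + 2) / (2 * q)).
  by rewrite yE; field; rewrite gt_eqF.
have c0 : 0 <= (q + 2) / (2 * q) by apply: divr_ge0; lra.
rewrite ger0_norm; last by rewrite E mulr_ge0// sqr_ge0.
apply: le_powR_interpolate => //; rewrite ?ler1n//.
  have : q^-1 <= 1 by rewrite invf_le1.
  lra.
rewrite E yE expr_div_n.
have -> : 2 * ((q ^+ 2 - 1) ^+ 2 / 2 ^+ 2) = (q - 1) ^+ 2 * ((q + 1) ^+ 2 / 2) by field.
apply: ler_wpM2l; first exact: sqr_ge0.
(* For q >= 1 the left side is at most 3/2, its value at q = 1, and the right side is at least 2. *)
apply: (@le_trans _ _ (3 / 2)).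
  rewrite ler_pdivrMr; last lra.
  have -> : 3 / 2 * (2 * q) = 3 * q by field.
  lra.
nra.
Qed.

Lemma pdensity_integralT (f g : R -> R) : pdensity f ->
  (\int[mu]_(x in `[0%R, +oo[) (g x * f x)%:E = \int[mu]_x (g x * f x)%:E)%E.
Proof.
move=> [_ _ fneg _]; rewrite integral_mkcond; apply: eq_integral => x _.
rewrite patchE mem_setE in_itv/= andbT; case: leP => // /ltW x0.
by rewrite fneg// mulr0.
Qed.

Lemma pdensity_integrable (f g : R -> R) : pdensity f ->
  measurable_fun [set: R] g -> (forall x, 0 < x -> `|g x| <= 1) ->
  mu.-integrable [set: R] (fun x => (g x * f x)%:E).
Proof.
move=> [mf f0 fneg f1] mg g1.
have fi : mu.-integrable [set: R] (EFin \o f).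
  apply/integrableP; split; first exact/measurable_EFinP.
  under eq_integral do rewrite /= ger0_norm//.
  by rewrite f1 ltry.
apply: le_integrable fi => //; first by apply/measurable_EFinP; exact: measurable_funM.
move=> x _ /=; rewrite lee_fin normrM; have [x0|x0] := leP x 0.
  by rewrite fneg// normr0 mulr0.
by rewrite ler_piMl// g1.
Qed.

Lemma pdensity_integrableT (f : R -> R) : pdensity f ->
  mu.-integrable [set: R] (EFin \o f).
Proof.
move=> df; have := pdensity_integrable f (cst 1) df.
rewrite (_ : (fun x => _) = EFin \o f); last by apply/funext => x; rewrite mul1r.
by apply => // x _; rewrite normr1.
Qed.

Lemma expRN_le1 (s x : R) : 0 <= s -> 0 < x -> `|expR (- (s * x))| <= 1.
Proof.
move=> s0 x0; rewrite ger0_norm ?expR_ge0// -expR0 ler_expR oppr_le0.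
by rewrite mulr_ge0// ltW.
Qed.

Lemma laplaceE (f : R -> R) (s : R) :
  laplace f s = \int[mu]_x (expR (- (s * x)) * f x).
Proof. by []. Qed.

(** Integrates the pointwise bound (s x)^a on the remainder of e^(-s x) against [f]. Since x^a <= 1
    + x^alpha for x > 0, the constant can be taken as 1 plus the moment of order alpha. *)
Lemma laplace_taylor1_bound (f : R -> R) (alpha a w : R) : pdensity f ->
  1 <= a <= 2 -> a <= alpha ->
  (\int[mu]_x (x `^ alpha * f x)%:E < +oo)%E ->
  (\int[mu]_x (x * f x)%:E = w%:E)%E ->
  exists K, 0 <= K /\ forall s, 0 <= s ->
    `|laplace f s - 1 + w * s| <= K * s `^ a.
Proof.
move=> df a12 aal Malpha Mw; have [mf f0 fneg f1] := df.
have ia : mu.-integrable [set: R] (fun x => (x `^ alpha * f x)%:E).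
  apply/integrableP; split.
    by apply/measurable_EFinP; apply: measurable_funM => //; exact: measurable_powR.
  under eq_integral do rewrite /= ger0_norm ?mulr_ge0 ?powR_ge0//.
  exact: Malpha.
have ix : mu.-integrable [set: R] (fun x : R => (x * f x)%:E).
  apply/integrableP; split; first by apply/measurable_EFinP; exact: measurable_funM.
  rewrite [X in (X < _)%E](_ : _ = w%:E) ?ltry//; rewrite -Mw.
  apply: eq_integral => x _ /=.
  have [x0|x0] := leP x 0; first by rewrite fneg// mulr0 normr0.
  by rewrite ger0_norm// mulr_ge0// ltW.
have i1 := pdensity_integrableT f df.
pose K := \int[mu]_x (f x + x `^ alpha * f x).
have iK : mu.-integrable [set: R] (EFin \o (fun x : R => f x + x `^ alpha * f x)).
  exact: (integrableD measurableT i1 ia).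
exists K; split.
  by apply: Rintegral_ge0 => x _; rewrite addr_ge0// mulr_ge0// powR_ge0.
move=> s s0.
have iE : mu.-integrable [set: R] (fun x : R => (expR (- (s * x)) * f x)%:E).
  by apply: pdensity_integrable => // [|x]; [exact: measurable_expRNM|exact: expRN_le1].
have iE1 : mu.-integrable [set: R] (EFin \o (fun x : R => expR (- (s * x)) * f x - f x)).
  exact: (integrableB measurableT iE i1).
have isx : mu.-integrable [set: R] (EFin \o (fun x : R => s * (x * f x))).
  exact: (integrableZl measurableT s ix).
have iall : mu.-integrable [set: R] (EFin \o (fun x : R => expR (- (s * x)) * f x - f x + s * (x * f x))).
  exact: (integrableD measurableT iE1 isx).
have -> : laplace f s - 1 + w * s =
    \int[mu]_x (expR (- (s * x)) * f x - f x + s * (x * f x)).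
  rewrite RintegralD// RintegralB// RintegralZl//.
  by rewrite -laplaceE /Rintegral f1 Mw/= [w * s]mulrC.
apply: (le_trans (le_normr_Rintegral _ _)) => //.
rewrite mulrC -RintegralZl//; apply: le_Rintegral => //.
- exact: integrable_norm.
- exact: (integrableZl measurableT (s `^ a) iK).
move=> x _; have [x0|x0] := leP x 0.
  by rewrite fneg// !mulr0 subr0 !addr0 normr0 mulr0.
have -> : expR (- (s * x)) * f x - f x + s * (x * f x) =
   (expR (- (s * x)) - 1 + s * x) * f x by ring.
rewrite normrM (ger0_norm (f0 x)) -[X in _ <= _ * (X + _)]mul1r -mulrDl mulrA.
apply: ler_wpM2r => //.
have sx0 : 0 <= s * x by rewrite mulr_ge0// ltW.
apply: (le_trans (expRN_taylor1_bound _ _ a12 sx0)).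
rewrite powRM ?(ltW x0)// ler_wpM2l ?powR_ge0//.
have [x1|/ltW x1] := leP x 1.
  have : x `^ a <= 1.
    rewrite -(powRr0 x) ger_powR ?x0//; lra.
  have := powR_ge0 x alpha; lra.
have : x `^ a <= x `^ alpha by rewrite ler_powR.
lra.
Qed.

Lemma limit_laplace_ge0 (w s : R) : 0 <= limit_laplace w s.
Proof. by rewrite invr_ge0 sqrtr_ge0. Qed.

Lemma limit_laplace_le1 (w s : R) : 0 <= w -> 0 <= s -> limit_laplace w s <= 1.
Proof.
move=> w0 s0; have ws : 0 <= 2 * w * s by rewrite !mulr_ge0.
rewrite invf_le1 ?sqrtr_gt0 ?ltr_pwDl// -{1}sqrtr1 ler_wsqrtr//; lra.
Qed.

Lemma measurable_limit_laplace (w : R) :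
  measurable_fun [set: R] (limit_laplace w).
Proof.
apply: (measurableT_comp measurable_invr).
apply: (measurableT_comp (continuous_measurable_fun (@sqrt_continuous R))).
by apply: measurable_funD => //; exact: measurable_funM.
Qed.

(** * Contraction towards the fixed point *)

(** The bound D (s r)^a is homogeneous in r, so averaging over r in [0, 1] multiplies D s^a by 1/(a
    + 1). *)
Lemma mean_laplace_dist (f : R -> R) (a w D s : R) : pdensity f ->
  0 < a -> 0 < w -> 0 <= s -> 0 <= D ->
  (forall r, 0 <= r -> `|laplace f r - limit_laplace w r| <= D * r `^ a) ->
  `|mean_laplace f s - \int[mu]_(r in `[0, 1]) limit_laplace w (s * r)|
    <= D * s `^ a / (a + 1).
Proof.
move=> df a0 w0 s0 D0 dist; have w0' := ltW w0.
have iL := integrable_laplace _ _ df s0.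
have mscale : measurable_fun [set: R] (fun r => s * r) by exact: measurable_funM.
have iLL : mu.-integrable `[0, 1] (EFin \o (fun r => limit_laplace w (s * r))).
  apply: (integrable_bounded01 _ 1).
    exact: (measurableT_comp (measurable_limit_laplace w) mscale).
  move=> r /andP[r0 _]; rewrite ger0_norm ?limit_laplace_ge0//.
  by rewrite limit_laplace_le1// mulr_ge0.
have ia : mu.-integrable `[0, 1] (EFin \o (fun r : R => r `^ a)).
  apply: (integrable_bounded01 _ 1); first exact: measurable_powR.
  move=> r /andP[r0 r1]; rewrite ger0_norm ?powR_ge0//.
  rewrite [leRHS](_ : 1 = 1 `^ a); last by rewrite powR1.
  by apply: ge0_ler_powR; rewrite ?nnegrE// ltW.
have m01 : measurable (`[0, 1]%classic : set (measurableTypeR R)) by [].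
have iB := integrableB m01 iL iLL.
rewrite -RintegralB//; apply: (le_trans (le_normr_Rintegral _ _)) => //.
rewrite -integral_powR01// -RintegralZl//; apply: le_Rintegral => //.
- exact: integrable_norm.
- exact: (integrableZl m01 (D * s `^ a) ia).
- move=> r /=; rewrite in_itv/= => /andP[r0 _].
  by rewrite -mulrA -powRM// dist// mulr_ge0.
Qed.

Lemma laplace_contraction (f : nat -> R -> R) (a w D : R) :
  (forall t, pdensity (f t)) -> 0 < a -> 0 < w -> 0 <= D ->
  (forall t s, 0 <= s ->
    laplace (f t.+1) s = 2^-1 * (laplace (f t) s + 1) * mean_laplace (f t) s) ->
  (forall s, 0 <= s -> `|laplace (f 0%N) s - limit_laplace w s| <= D * s `^ a) ->
  forall t s, 0 <= s ->
    `|laplace (f t) s - limit_laplace w s| <= D * (2^-1 + (a + 1)^-1) ^+ t * s `^ a.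
Proof.
move=> df a0 w0 D0 step dist0; elim=> [|t IH] s s0.
  by rewrite expr0 mulr1 dist0.
have c0 : 0 <= 2^-1 + (a + 1)^-1 by rewrite addr_ge0// invr_ge0; lra.
set D' := D * (2^-1 + (a + 1)^-1) ^+ t in IH *.
have D'0 : 0 <= D' by rewrite mulr_ge0// exprn_ge0.
have -> : D * (2^-1 + (a + 1)^-1) ^+ t.+1 = D' * (2^-1 + (a + 1)^-1).
  by rewrite exprSr mulrA.
(* At s = 0 both transforms equal 1; the fixed-point identity is available only for s > 0. *)
move: (s0); rewrite le_eqVlt => /predU1P[<-|s1].
  rewrite laplace0// /limit_laplace mulr0 addr0 sqrtr1 invr1 subrr normr0.
  by rewrite mulr_ge0 ?powR_ge0// mulr_ge0.
rewrite step// [limit_laplace w s]limit_laplace_fixpoint//.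
have := mean_laplace_dist _ _ _ _ _ (df t) a0 w0 s0 D'0 IH.
set A := mean_laplace _ _; set A' := \int[mu]_(r in _) _ => distA.
have A01 : 0 <= A <= 1.
  rewrite Rintegral_ge0//=; last by move=> r _; exact: laplace_ge0.
  rewrite /A /mean_laplace [leRHS](_ : 1 = \int[mu]_(x in `[0, 1]) (1 : R)); last first.
    by rewrite Rintegral_cst//= lebesgue_measure_itv/= lte01 oppr0 adde0/= mulr1.
  apply: le_Rintegral => //; first exact: integrable_laplace.
    by apply: (integrable_bounded01 (cst 1) 1) => // r _; rewrite normr1.
  move=> r /=; rewrite in_itv/= => /andP[r0 _]; apply: laplace_le1 => //.
  exact: mulr_ge0.
have L1 := limit_laplace_le1 w s (ltW w0) s0.
have L0 := limit_laplace_ge0 w s.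
have IHs := IH s s0.
set L := limit_laplace w s in L0 L1 IHs *; set l := laplace _ s in IHs *.
(* The difference of products is split so that l - L has weight A/2 <= 1/2 and A - A' has weight (L
   + 1)/2 <= 1; this yields the two terms of the factor 1/2 + 1/(a + 1). *)
have -> : 2^-1 * (l + 1) * A - 2^-1 * (L + 1) * A' =
   2^-1 * A * (l - L) + 2^-1 * (L + 1) * (A - A') by ring.
apply: (le_trans (ler_normD _ _)); rewrite !normrM.
have -> : D' * (2^-1 + (a + 1)^-1) * s `^ a = 2^-1 * (D' * s `^ a) + D' * s `^ a / (a + 1) by ring.
case/andP: A01 => A0 A1.
rewrite (ger0_norm A0) ger0_norm ?invr_ge0//; apply: lerD.
  by apply: ler_pM => //; [rewrite mulr_ge0// invr_ge0|lra].
rewrite -[leRHS]mul1r; apply: ler_pM => //.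
by rewrite ger0_norm; lra.
Qed.

Lemma laplace_cvg (f : nat -> R -> R) (a w D : R) :
  (forall t, pdensity (f t)) -> 1 < a -> 0 < w -> 0 <= D ->
  (forall t s, 0 <= s ->
    laplace (f t.+1) s = 2^-1 * (laplace (f t) s + 1) * mean_laplace (f t) s) ->
  (forall s, 0 <= s -> `|laplace (f 0%N) s - limit_laplace w s| <= D * s `^ a) ->
  forall s, 0 <= s -> laplace (f t) s @[t --> \oo] --> limit_laplace w s.
Proof.
move=> df a1 w0 D0 step dist0 s s0.
have a0 : 0 < a by lra.
have c0 : 0 < (a + 1)^-1 by rewrite invr_gt0; lra.
(* This is where a > 1 enters: it makes the contraction factor smaller than 1. *)
have c1 : (a + 1)^-1 < 2^-1 by rewrite ltf_pV2 ?posrE; lra.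
apply/cvgrPdist_le => e e0.
have : D * (2^-1 + (a + 1)^-1) ^+ t * s `^ a @[t --> \oo] --> D * 0 * s `^ a.
  apply: cvgMl; apply: cvgMr; apply: cvg_expr.
  by rewrite ger0_norm; lra.
rewrite mulr0 mul0r => /cvgrPdist_le/(_ _ e0).
apply: filterS => t; rewrite sub0r normrN => H.
rewrite distrC; apply: (le_trans _ H); apply: le_trans (ler_norm _).
exact: laplace_contraction.
Qed.

(** * Mass and Laplace transform of p*_w *)

(** Monotone convergence: the intervals exhaust (0, +oo), and the point 0 is null. It lets the
    substitution y = c sqrt x be made away from 0, where the square root is not differentiable. *)
Lemma integral_itv_decr0_cvg (g : R -> R) (u : nat -> R) :
  measurable_fun [set: R] g -> (forall x, 0 <= g x) ->
  (forall n, 0 < u n) -> nonincreasing_seq u -> u n @[n --> \oo] --> (0 : R) ->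
  (\int[mu]_(x in `[u n, +oo[) (g x)%:E @[n --> \oo] -->
   \int[mu]_(x in `[0%R, +oo[) (g x)%:E)%E.
Proof.
move=> mg g0 u0 ndu u_0; rewrite -integral_itv_obnd_cbnd; last first.
  by apply: measurable_funTS; exact/measurable_EFinP.
have <- : \bigcup_n `[u n, +oo[%classic = `]0, +oo[%classic.
  apply/seteqP; split => x /=.
    move=> [n _] /=; rewrite !in_itv/= !andbT; exact: lt_le_trans.
  rewrite in_itv/= andbT => x0.
  have /cvgrPdist_lt/(_ _ x0)[n _ /(_ n (leqnn n))] := u_0.
  rewrite sub0r normrN gtr0_norm// => un; exists n => //=.
  by rewrite in_itv/= andbT ltW.
apply: ge0_nondecreasing_set_cvg_integral => //.
- move=> m n mn; apply/subsetPset => x /=; rewrite !in_itv/= !andbT.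
  by apply: le_trans; exact: ndu.
- by move=> n; apply: measurable_funTS; exact/measurable_EFinP.
- by move=> n x _; rewrite lee_fin.
Qed.

(* The substitution is y = c sqrt x, not x = (y / c)^2: the substitution lemma
   requires a derivative with a finite limit at +oo. *)
Lemma integral_gauss_sqrt_itv (c a : R) : 0 < c -> 0 < a ->
  (\int[mu]_(y in `[(c * Num.sqrt a)%R, +oo[) (gauss_fun y)%:E =
   \int[mu]_(x in `[a, +oo[) (expR (- (c ^+ 2 * x)) * (c / (2 * Num.sqrt x)))%:E)%E.
Proof.
move=> c0 a0; pose F (x : R) := c * Num.sqrt x.
pose h (x : R) := c * (2 * Num.sqrt x)^-1.
have dF (x : R) : 0 < x -> is_derive x 1 F (h x).
  by move=> x0; have d := is_derive1_sqrt x0; apply: is_derive_eq.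
have FE (x : R) : 0 < x -> derive1 F x = h x.
  by move=> x0; have d := dF x x0; rewrite derive1E derive_val.
have cF (x : R) : 0 < x -> {for x, continuous F}.
  by move=> x0; have d := dF x x0; apply/differentiable_continuous/derivable1_diffP.
have cF' (x : R) : 0 < x -> {for x, continuous (derive1 F)}.
  move=> x0; rewrite /prop_for /continuous_at FE//.
  have ch : h y @[y --> x] --> h x.
    apply: cvgMr; apply: cvgV; first by rewrite gt_eqF// mulr_gt0// sqrtr_gt0.
    by apply: cvgMr; exact: sqrt_continuous.
  apply: cvg_trans ch; apply: near_eq_cvg.
  near=> y; rewrite FE//; near: y; exact: lt_nbhsr.
have large (M : R) : \forall x \near +oo, M <= Num.sqrt x.
  have := @nbhs_pinfty_ge R (M ^+ 2) (num_real _); apply: filterS => x Mx.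
  by apply: (le_trans (ler_norm M)); rewrite -sqrtr_sqr ler_wsqrtr.
rewrite (@increasing_ge0_integration_by_substitutiony _ F gauss_fun a).
- apply: eq_integral => x; rewrite inE/= in_itv/= andbT => ax.
  have x0 : 0 < x by exact: lt_le_trans ax.
  rewrite /= !fctE FE// /gauss_fun /F exprMn sqr_sqrtr// ltW//.
- move=> x y; rewrite !in_itv/= !andbT => ax ay xy.
  by rewrite ltr_pM2l// ltr_sqrt// (lt_trans _ xy)// (lt_le_trans a0).
- by move=> x; rewrite in_itv/= andbT => ax; apply: cF'; exact: lt_trans ax.
- by apply: cvgP; exact/cvg_at_right_filter/cF'.
- apply/cvg_ex; exists 0 => /=; apply/cvgrPdist_le => e e0; near=> x.
  have x0 : 0 < x by near: x; exact: nbhs_pinfty_gt.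
  rewrite FE// sub0r normrN /h ger0_norm; last first.
    by rewrite mulr_ge0 ?invr_ge0 ?mulr_ge0 ?sqrtr_ge0// ltW.
  have sx : 0 < Num.sqrt x by rewrite sqrtr_gt0.
  rewrite ler_pdivrMr ?mulr_gt0//.
  have : c / e <= Num.sqrt x by near: x; exact: large.
  rewrite ler_pdivrMr// => H; nra.
- split; last exact/cvg_at_right_filter/cF.
  move=> x; rewrite in_itv/= andbT => ax; have := dF x (lt_trans a0 ax).
  by case.
- apply/cvgryPge => M; near=> x.
  have : M / c <= Num.sqrt x by near: x; exact: large.
  by rewrite ler_pdivrMr// mulrC.
- by apply: continuous_subspaceT; exact: continuous_gauss_fun.
- by move=> x _; exact: gauss_fun_ge0.
Unshelve. all: by end_near. Qed.

(** Along u_n = 1/(n + 1) the truncated integrals on both sides of the substitution coincide, so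
    their limits do; the Gaussian one is known. *)
Lemma integral_gauss_sqrt (c : R) : 0 < c ->
  (\int[mu]_(x in `[0%R, +oo[) (expR (- (c ^+ 2 * x)) * (c / (2 * Num.sqrt x)))%:E =
   (Num.sqrt pi / 2)%:E)%E.
Proof.
move=> c0; pose u (n : nat) : R := n.+1%:R^-1.
have u0 n : 0 < u n by rewrite invr_gt0.
have ndu : nonincreasing_seq u.
  by move=> m n mn; rewrite lef_pV2 ?posrE// ler_nat ltnS.
have u_0 : u n @[n --> \oo] --> (0 : R) by exact: cvg_harmonic.
have mh : measurable_fun [set: R]
    (fun x => expR (- (c ^+ 2 * x)) * (c / (2 * Num.sqrt x))).
  apply: measurable_funM; first exact: measurable_expRNM.
  apply: measurable_funM => //; apply: (measurableT_comp measurable_invr).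
  apply: measurable_funM => //; apply: continuous_measurable_fun.
  exact: sqrt_continuous.
have h0 (x : R) : 0 <= expR (- (c ^+ 2 * x)) * (c / (2 * Num.sqrt x)).
  by rewrite mulr_ge0 ?expR_ge0// divr_ge0 ?(ltW c0)// mulr_ge0.
have l1 := integral_itv_decr0_cvg _ u mh h0 u0 ndu u_0.
have l2 : (\int[mu]_(y in `[(c * Num.sqrt (u n))%R, +oo[) (gauss_fun y)%:E
    @[n --> \oo] --> \int[mu]_(y in `[0%R, +oo[) (gauss_fun y)%:E)%E.
  apply: (integral_itv_decr0_cvg _ (fun n => c * Num.sqrt (u n))).
  - exact: measurable_gauss_fun.
  - by move=> x; exact: gauss_fun_ge0.
  - by move=> n; rewrite mulr_gt0// sqrtr_gt0.
  - by move=> m n mn; rewrite ler_pM2l// ler_wsqrtr// ndu.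
  - rewrite -[X in _ --> X](mulr0 c); apply: cvgMr; rewrite -[X in _ --> X]sqrtr0.
    exact: (cvg_comp _ _ u_0 (@sqrt_continuous R 0)).
rewrite -integral0y_gauss; move: l2; rewrite (eq_cvg _ _ (fun n =>
  integral_gauss_sqrt_itv c (u n) c0 (u0 n))) => l2.
exact: (cvg_unique (@ereal_hausdorff R) l1 l2).
Qed.

(** Exhibits p*_w as a multiple of the integrand of [integral_gauss_sqrt] with c = (2 w)^(-1/2). *)
Lemma pstarE (w x : R) : 0 < w -> pstar w x = (2 / Num.sqrt pi) *
  (expR (- ((Num.sqrt (2 * w))^-1 ^+ 2 * x)) * ((Num.sqrt (2 * w))^-1 / (2 * Num.sqrt x))).
Proof.
move=> w0; have w20 : 0 < 2 * w by rewrite mulr_gt0.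
rewrite /pstar exprVn sqr_sqrtr ?(ltW w20)//.
have -> : Num.sqrt (2 * w * pi * x) = Num.sqrt (2 * w) * Num.sqrt pi * Num.sqrt x.
  have w2 := ltW w20; have w2p : 0 <= 2 * w * pi by rewrite mulr_ge0// pi_ge0.
  by rewrite (sqrtrM _ w2p) (sqrtrM _ w2).
rewrite [(2 * w)^-1 * x]mulrC !invfM.
move: (Num.sqrt pi)^-1 (Num.sqrt x)^-1 (Num.sqrt (2 * w))^-1 => a b c.
by field.
Qed.

Lemma pdensity_pstar (w : R) : 0 < w -> pdensity (pstar w).
Proof.
move=> w0; have p0 x : 0 <= pstar w x by rewrite mulr_ge0 ?expR_ge0// invr_ge0.
have mp : measurable_fun [set: R] (pstar w).
  apply: measurable_funM.
    apply: (measurableT_comp measurable_invr).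
    apply: (measurableT_comp (continuous_measurable_fun (@sqrt_continuous R))).
    exact: measurable_funM.
  apply: measurableT_comp => //; apply: measurableT_comp => //.
  exact: measurable_funM.
(* [Num.sqrt] is 0 at negative numbers too, so the inverse is again 0. *)
have pneg x : x <= 0 -> pstar w x = 0.
  move=> x0; rewrite /pstar ler0_sqrtr ?invr0 ?mul0r//.
  by rewrite mulr_ge0_le0// mulr_ge0 ?pi_ge0// mulr_ge0// ltW.
split => //.
have -> : (\int[mu]_x (pstar w x)%:E = \int[mu]_(x in `[0%R, +oo[) (pstar w x)%:E)%E.
  rewrite [RHS]integral_mkcond; apply: eq_integral => x _.
  by rewrite patchE mem_setE in_itv/= andbT; case: leP => // /ltW/pneg ->.
under eq_integral do rewrite pstarE// EFinM.
have c0 : 0 < (Num.sqrt (2 * w))^-1 by rewrite invr_gt0 sqrtr_gt0 mulr_gt0.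
have q0 : 0 < Num.sqrt pi :> R by rewrite sqrtr_gt0 pi_gt0.
rewrite ge0_integralZl//.
- rewrite integral_gauss_sqrt// -EFinM; congr EFin.
  by field; rewrite gt_eqF.
- apply: measurable_funTS; apply/measurable_EFinP.
  apply: measurable_funM; first exact: measurable_expRNM.
  apply: measurable_funM => //; apply: (measurableT_comp measurable_invr).
  apply: measurable_funM => //; apply: continuous_measurable_fun.
  exact: sqrt_continuous.
Qed.

Lemma laplace_pstar (w s : R) : 0 < w -> 0 <= s ->
  laplace (pstar w) s = limit_laplace w s.
Proof.
move=> w0 s0; have sw : 0 <= 2 * w * s by rewrite !mulr_ge0// ltW.
set q := Num.sqrt (1 + 2 * w * s).
have q0 : 0 < q by rewrite sqrtr_gt0; lra.
have qq : q ^+ 2 = 1 + 2 * w * s by rewrite sqr_sqrtr//; lra.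
(* Adding s to the exponential rate 1/(2 w) gives q^2 / (2 w), the rate for the parameter w /
   q^2. *)
have w'0 : 0 < w / q ^+ 2 by rewrite divr_gt0// exprn_gt0.
have [mf' f0' _ f1'] := pdensity_pstar _ w'0.
rewrite laplaceE /limit_laplace -/q.
(* Exponential tilting only rescales w: no new integral is needed. *)
have E x : expR (- (s * x)) * pstar w x = q^-1 * pstar (w / q ^+ 2) x.
  rewrite /pstar mulrCA -expRD mulrA -invfM; congr (_^-1 * expR _).
    transitivity (Num.sqrt (q ^+ 2) * Num.sqrt (2 * (w / q ^+ 2) * pi * x)).
      by rewrite -sqrtrM ?sqr_ge0//; congr Num.sqrt; field; rewrite gt_eqF.
    by rewrite sqrtr_sqr ger0_norm// ltW.
  rewrite qq; field; rewrite !gt_eqF//; lra.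
under eq_Rintegral do rewrite E.
rewrite RintegralZl//; last exact: pdensity_integrableT (pdensity_pstar _ w'0).
by rewrite /Rintegral f1' mulr1.
Qed.

(** * Smooth steps built from exponentials *)

(** For nu > 0, m >= 1 and x >= 0, the distribution function of the maximum of m independent
    exponential variables of rate nu. *)
Definition cutoff (nu : R) (m : nat) (x : R) : R := (1 - expR (- (nu * x))) ^+ m.

Lemma cutoff_itv01 (nu : R) (m : nat) (x : R) : 0 <= nu -> 0 <= x ->
  0 <= cutoff nu m x <= 1.
Proof.
move=> nu0 x0; have e0 := expR_ge0 (- (nu * x)).
have e1 : expR (- (nu * x)) <= 1 by rewrite -expR0 ler_expR oppr_le0 mulr_ge0.
by rewrite exprn_ge0 ?exprn_ile1//; lra.
Qed.

Lemma measurable_cutoff (nu : R) (m : nat) : measurable_fun [set: R] (cutoff nu m).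
Proof.
apply: measurable_funX; apply: measurable_funB => //; exact: measurable_expRNM.
Qed.

Lemma bernoulli_ge (z : R) (m : nat) : 0 <= z <= 1 -> 1 - m%:R * z <= (1 - z) ^+ m.
Proof.
move=> /andP[z0 z1]; elim: m => [|m IH]; first by rewrite mul0r subr0 expr0.
rewrite exprSr; apply: (@le_trans _ _ ((1 - m%:R * z) * (1 - z))); last first.
  by apply: ler_wpM2r => //; lra.
have := ler0n R m; rewrite -natr1 => m0; nra.
Qed.

(** Induction, from (1 - z) (1 + (m + 1) z) <= 1 + m z. *)
Lemma bernoulli_le (z : R) (m : nat) : 0 <= z <= 1 -> (1 - z) ^+ m <= (1 + m%:R * z)^-1.
Proof.
move=> /andP[z0 z1]; have pos k : 0 < 1 + k%:R * z by rewrite ltr_pwDl// mulr_ge0.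
rewrite -[leRHS]mul1r ler_pdivlMr//; elim: m => [|m IH]; first by rewrite mul0r addr0 expr0 mulr1.
apply: le_trans IH; rewrite exprSr -mulrA; apply: ler_wpM2l; first by rewrite exprn_ge0//; lra.
have := ler0n R m; rewrite -natr1 => m0; nra.
Qed.

(** With c the midpoint of a and b, d half their distance and m close to e^(nu c), the quantity m
    e^(-nu y) is at least about e^(nu d) for y <= a and at most e^(-nu d) for y >= b. The two
    Bernoulli inequalities turn this into the bounds. *)
Lemma cutoff_exists (a b e : R) : 0 <= a -> a < b -> 0 < e ->
  exists nu m, [/\ 0 <= nu, forall y, 0 <= y -> y <= a -> cutoff nu m y <= e &
    forall y, b <= y -> 1 - e <= cutoff nu m y].
Proof.
(* [nu] is chosen so that nu d = 1/e, whence e^(-nu d) <= e because e^(1/e) >= 1/e. *)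
move=> a0 ab e0; pose d := (b - a) / 2; pose nu := e^-1 / d.
have d0 : 0 < d by rewrite divr_gt0// subr_gt0.
have nu0 : 0 <= nu by rewrite divr_ge0 ?invr_ge0// ltW.
have ed : expR (- (nu * d)) <= e.
  rewrite expRN -[leRHS]invrK lef_pV2 ?posrE ?expR_gt0 ?invr_gt0//.
  rewrite /nu divfK ?gt_eqF//; apply: le_trans (expR_ge1Dx _); lra.
pose c := (a + b) / 2; pose m := Num.truncn (expR (nu * c)).
have /andP[m1 m2] : m%:R <= expR (nu * c) < m.+1%:R.
  by apply: truncn_itv; exact: expR_ge0.
exists nu, m; split => //.
- move=> y y0 ya; apply: (le_trans (bernoulli_le _ _ _)).
    by rewrite expR_ge0/= -expR0 ler_expR oppr_le0 mulr_ge0.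
  apply: le_trans ed; rewrite [leRHS]expRN lef_pV2 ?posrE ?expR_gt0//.
  have za : expR (- (nu * a)) <= expR (- (nu * y)).
    by rewrite ler_expR lerN2 ler_wpM2l.
  have z1 : expR (- (nu * a)) <= 1 by rewrite -expR0 ler_expR oppr_le0 mulr_ge0.
  have zy0 := expR_ge0 (- (nu * a)).
  have -> : nu * d = nu * c + (- (nu * a)) by rewrite /c /d; field.
  rewrite expRD; rewrite -natr1 in m2.
  have := ler_wpM2l (ler0n R m) za.
  (* Truncating e^(nu c) to an integer loses at most e^(-nu a) <= 1 here, which the 1 in 1 + m z
     absorbs. *)
  have : (expR (nu * c) - 1) * expR (- (nu * a)) <= m%:R * expR (- (nu * a)).
    by apply: ler_wpM2r => //; lra.
  lra.
- move=> y yb; have y0 : 0 <= y by lra.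
  apply: le_trans (bernoulli_ge _ _ _); last first.
    by rewrite expR_ge0/= -expR0 ler_expR oppr_le0 mulr_ge0.
  rewrite lerD2l lerN2; apply: le_trans ed.
  have -> : - (nu * d) = nu * c + (- (nu * b)) by rewrite /c /d; field.
  rewrite expRD; apply: ler_pM => //.
  by rewrite ler_expR lerN2 ler_wpM2l.
Qed.

(** The exponential weight makes an induction on m possible: a further factor 1 - e^(-nu x) gives
    the difference of the integrals for m at s and at s + nu. *)
Lemma cutoff_integral_cvg (f : nat -> R -> R) (g : R -> R) (nu : R) (m : nat) (s : R) :
  (forall t, pdensity (f t)) -> pdensity g ->
  (forall s, 0 <= s -> laplace (f t) s @[t --> \oo] --> laplace g s) ->
  0 <= nu -> 0 <= s ->
  \int[mu]_x (expR (- (s * x)) * cutoff nu m x * f t x) @[t --> \oo] -->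
  \int[mu]_x (expR (- (s * x)) * cutoff nu m x * g x).
Proof.
move=> df dg fg nu0; elim: m s => [|m IH] s s0.
  have E k : \int[mu]_x (expR (- (s * x)) * cutoff nu 0 x * k x) = laplace k s.
    by apply: eq_Rintegral => x _; rewrite /cutoff expr0 mulr1.
  by rewrite (eq_cvg _ _ (fun t => E (f t))) E; exact: fg.
have int k r : 0 <= r -> pdensity k ->
    mu.-integrable [set: R] (fun x => (expR (- (r * x)) * cutoff nu m x * k x)%:E).
  move=> r0 dk; apply: (pdensity_integrable k (fun x => expR (- (r * x)) * cutoff nu m x) dk).
    by apply: measurable_funM; [exact: measurable_expRNM|exact: measurable_cutoff].
  move=> x x0; have /andP[c0 c1] := cutoff_itv01 _ m _ nu0 (ltW x0).
  rewrite normrM; apply: mulr_ile1 => //; first exact: expRN_le1.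
  by rewrite ger0_norm.
have E k : pdensity k -> \int[mu]_x (expR (- (s * x)) * cutoff nu m.+1 x * k x) =
    \int[mu]_x (expR (- (s * x)) * cutoff nu m x * k x) -
    \int[mu]_x (expR (- ((s + nu) * x)) * cutoff nu m x * k x).
  move=> dk; rewrite -RintegralB//; last 2 first.
  - exact: int.
  - by apply: int => //; exact: addr_ge0.
  apply: eq_Rintegral => x _.
  rewrite mulrDl opprD expRD /cutoff exprS; ring.
rewrite (eq_cvg _ _ (fun t => E (f t) (df t))) E//.
by apply: cvgB; apply: IH => //; exact: addr_ge0.
Qed.

(** * From Laplace transforms to distribution functions *)

Definition cdf (f : R -> R) (x : R) : R := \int[mu]_(y in `[0, x]) f y.

Lemma cdfE (f : R -> R) (x : R) : pdensity f ->
  (\int[mu]_(y in `[0%R, x]) (f y)%:E)%E = (cdf f x)%:E.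
Proof.
move=> df; rewrite fineK//; apply: integrable_fin_num => //.
by apply: integrableS (pdensity_integrableT f df).
Qed.

Lemma cdf_indic (f : R -> R) (x : R) :
  cdf f x = \int[mu]_y (\1_(`[0, x]) y * f y).
Proof.
rewrite /cdf Rintegral_mkcond; apply: eq_Rintegral => y _.
by rewrite patchE indicE; case: ifPn => _; rewrite ?mul1r ?mul0r.
Qed.

Lemma pdensity_le_integral (f g h : R -> R) (e : R) : pdensity f ->
  0 <= e -> measurable_fun [set: R] g -> measurable_fun [set: R] h ->
  (forall x, 0 < x -> `|g x| <= 1) -> (forall x, 0 < x -> `|h x| <= 1) ->
  (forall x, 0 < x -> g x <= h x + e) ->
  \int[mu]_x (g x * f x) <= \int[mu]_x (h x * f x) + e.
Proof.
move=> df e0 mg mh g1 h1 gh; have [_ f0 fneg f1] := df.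
have ig := pdensity_integrable f g df mg g1.
have ih := pdensity_integrable f h df mh h1.
have i1 := pdensity_integrableT f df.
have ie : mu.-integrable [set: R] (EFin \o (fun x => e * f x)).
  exact: (integrableZl measurableT e i1).
have -> : e = \int[mu]_x (e * f x).
  by rewrite RintegralZl// [X in _ * X]/Rintegral f1 mulr1.
rewrite -RintegralD//; apply: le_Rintegral => //.
  exact: (integrableD measurableT ih ie).
move=> x _; have [x0|x0] := leP x 0; first by rewrite fneg// !mulr0 addr0.
by rewrite -mulrDl ler_wpM2r// gh.
Qed.

(** Distribution functions are squeezed between integrals of smooth steps, which converge;
    continuity of [cdf g] at x controls the width of the steps. *)
Lemma laplace_continuity (f : nat -> R -> R) (g : R -> R) (x : R) :
  (forall t, pdensity (f t)) -> pdensity g ->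
  (forall s, 0 <= s -> laplace (f t) s @[t --> \oo] --> laplace g s) ->
  0 < x -> cdf (f t) x @[t --> \oo] --> cdf g x.
Proof.
move=> df dg fg x0.
(* A smoothed distribution function: if the step rises between a and b, then [J] lies between the
   values of [cdf k] at a and b, up to an error e on each side. *)
pose J nu m (k : R -> R) := \int[mu]_y ((1 - cutoff nu m y) * k y).
have mi b : measurable_fun [set: R] (\1_(`[0%R, b]%classic) : R -> R).
  exact: measurable_indic.
have mc nu m : measurable_fun [set: R] (fun y => 1 - cutoff nu m y).
  by apply: measurable_funB => //; exact: measurable_cutoff.
have i1 b y : `|\1_(`[0%R, b]%classic) y : R| <= 1.
  by rewrite indicE; case: (_ \in _); rewrite ?normr1 ?normr0.
have c1 nu m y : 0 <= nu -> 0 < y -> `|1 - cutoff nu m y| <= 1.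
  move=> nu0 y0; have := cutoff_itv01 nu m y nu0 (ltW y0).
  by move=> /andP[? ?]; rewrite ger0_norm; lra.
have upper k a e nu m : pdensity k -> 0 <= e -> 0 <= nu ->
    (forall y, 0 <= y -> y <= a -> cutoff nu m y <= e) -> cdf k a <= J nu m k + e.
  move=> dk e0 nu0 H; rewrite cdf_indic; apply: pdensity_le_integral => //.
    by move=> y y0; exact: c1.
  move=> y y0; rewrite indicE mem_setE in_itv/= (ltW y0)/=.
  have /andP[? ?] := cutoff_itv01 nu m y nu0 (ltW y0).
  have [ya|ya] := leP y a => /=; last lra.
  by have := H y (ltW y0) ya; rewrite mulr1n; lra.
have lower k b e nu m : pdensity k -> 0 <= e -> 0 <= nu ->
    (forall y, b <= y -> 1 - e <= cutoff nu m y) -> J nu m k <= cdf k b + e.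
  move=> dk e0 nu0 H; rewrite cdf_indic; apply: pdensity_le_integral => //.
    by move=> y y0; exact: c1.
  move=> y y0; rewrite indicE mem_setE in_itv/= (ltW y0)/=.
  have /andP[? ?] := cutoff_itv01 nu m y nu0 (ltW y0).
  have [ya|/ltW ya] := leP y b => /=; first by rewrite mulr1n; lra.
  by have := H y ya; lra.
have Jcvg nu m : 0 <= nu -> J nu m (f t) @[t --> \oo] --> J nu m g.
  move=> nu0.
  (* The constant 1 integrates to the transform at 0, and the cutoff term is the weighted integral
     at s = 0. *)
  have E k : pdensity k -> J nu m k =
      laplace k 0 - \int[mu]_y (expR (- (0 * y)) * cutoff nu m y * k y).
    move=> dk; rewrite laplaceE -RintegralB//; last 2 first.
    - by apply: pdensity_integrable => // [|y]; [exact: measurable_expRNM|exact: expRN_le1].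
    - apply: (pdensity_integrable k (fun x => expR (- (0 * x)) * cutoff nu m x) dk).
        by apply: measurable_funM; [exact: measurable_expRNM|exact: measurable_cutoff].
      move=> y y0; have /andP[? ?] := cutoff_itv01 nu m y nu0 (ltW y0).
      by rewrite mul0r oppr0 expR0 mul1r ger0_norm.
    by apply: eq_Rintegral => y _; rewrite mul0r oppr0 expR0; ring.
  rewrite (eq_cvg _ _ (fun t => E (f t) (df t))) E//.
  by apply: cvgB; [exact: fg|exact: cutoff_integral_cvg].
have cg : {for x, continuous (cdf g)}.
  have x1 : 0 < x + 1 by lra.
  have ig : mu.-integrable `[0, x + 1] (EFin \o g).
    by apply: integrableS (pdensity_integrableT g dg).
  have /(continuous_within_itvP _ x1)[H _ _] :=
    parameterized_integral_continuous (ltW x1) ig.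
  by apply: H; rewrite in_itv/= x0/=; lra.
apply/cvgrPdist_le => e e0.
pose e4 := e / 4; have e40 : 0 < e4 by rewrite divr_gt0.
have /cvgrPdist_le/(_ _ e40)/nbhs_ballP[d/= d0 Hd] := cg.
(* The bound x / 2 keeps x - d' positive, as the smooth step on [x - d', x] requires. *)
pose d' := Num.min (d / 2) (x / 2).
have d'0 : 0 < d' by rewrite lt_min !divr_gt0.
have d'd : d' < d.
  by rewrite (@le_lt_trans _ _ (d / 2))// ?ge_min ?lexx//; lra.
have d'x : d' <= x / 2 by rewrite ge_min lexx orbT.
have /ler_normlP[gr1 gr2] : `|cdf g x - cdf g (x + d')| <= e4.
  by apply: Hd; rewrite /ball/= opprD addrA subrr add0r normrN gtr0_norm.
have /ler_normlP[gl1 gl2] : `|cdf g x - cdf g (x - d')| <= e4.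
  by apply: Hd; rewrite /ball/= opprB addrCA subrr addr0 gtr0_norm.
have [|nu1 [m1 [nu10 A1 B1]]] := cutoff_exists x (x + d') e4 (ltW x0) _ e40; first lra.
have [||nu2 [m2 [nu20 A2 B2]]] := cutoff_exists (x - d') x e4 _ _ e40; [lra|lra|].
have /cvgrPdist_le/(_ _ e40) C1 := Jcvg nu1 m1 nu10.
have /cvgrPdist_le/(_ _ e40) C2 := Jcvg nu2 m2 nu20.
apply: filterS2 C1 C2 => t /ler_normlP[C11 C12] /ler_normlP[C21 C22].
(* From above, [cdf (f t) x] is compared in turn with [J] of [f t], [J] of [g], [cdf g (x + d')] and
   [cdf g x]; from below likewise through x - d'. Each of the four comparisons costs [e4]. *)
have U1 := upper (f t) x e4 nu1 m1 (df t) (ltW e40) nu10 A1.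
have L1 := lower g (x + d') e4 nu1 m1 dg (ltW e40) nu10 B1.
have U2 := upper g (x - d') e4 nu2 m2 dg (ltW e40) nu20 A2.
have L2 := lower (f t) x e4 nu2 m2 (df t) (ltW e40) nu20 B2.
have e4E : e = 4 * e4 by rewrite /e4; field.
by apply/ler_normlP; split; lra.
Qed.

(** * Transfer to the given sequence and conclusion *)

(** Representatives are chosen separately for each t, so the one chosen at t + 1 need not be the one
    that the recursion produces from time t; their transforms agree all the same. *)
Lemma represented_laplace_eq (f g p : R -> R) (s : R) :
  pdensity f -> pdensity g -> represented f p -> represented g p ->
  laplace f s = laplace g s.
Proof.
move=> df dg pf pg; congr fine.
have E k : pdensity k -> represented k p -> elaplace (EFin \o k) s =
    (\int[mu]_(x in `[0%R, +oo[) (expR (- (s * x)) * p x)%:E)%E.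
  move=> dk pk.
  rewrite (represented_integral k p _ (fun x => expR (- (s * x))))//.
    by rewrite pdensity_integralT.
  exact: measurable_expRNM.
by rewrite (E f)// (E g).
Qed.

Lemma represented_primitive0 (f p : R -> R) (x : R) :
  pdensity f -> represented f p -> primitive0 p x = (cdf f x)%:E.
Proof.
move=> df pf; rewrite -cdfE// /primitive0.
have := represented_integral f p `[0, x]%classic (cst 1) df pf.
under eq_integral do rewrite mul1r.
move=> ->//; first by under eq_integral do rewrite mul1r.
by move=> y /=; rewrite !in_itv/= andbT => /andP[].
Qed.

Lemma represented_moment (f p : R -> R) (a : R) :
  pdensity f -> represented f p ->
  (moment a p = \int[mu]_x (x `^ a * f x)%:E)%E.
Proof.
move=> df pf; rewrite -pdensity_integralT//.
by apply: (represented_integral f p _ (fun x => x `^ a)) => //; exact: measurable_powR.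
Qed.

End RandomExchange.

Theorem theorem2 (R : realType) (alpha w : R) (p : nat -> R -> R)
    (halpha : 1 < alpha) (hw : 0 < w)
    (hp0 : density_class alpha w (p 0%N))
    (hpS : forall t : nat, represents (p t.+1) (T_op (p t)))
    (x : R) (hx : 0 <= x) :
  primitive0 (p t) x @[t --> \oo] --> primitive0 (pstar w) x.
Proof.
have [hd hmom hmean] := hp0.
have /choice[f rf] : forall t, exists f, pdensity f /\ represented f (p t).
  elim=> [|t [f [df pf]]]; first exact: density_represented.
  by have [g [dg qg _]] := T_op_step _ _ _ df pf (hpS t); exists g.
have df t := (rf t).1.
have pf t := (rf t).2.
have step t s : 0 <= s ->
    laplace (f t.+1) s = 2^-1 * (laplace (f t) s + 1) * mean_laplace (f t) s.
  move=> s0; have [g [dg qg <-//]] := T_op_step _ _ _ (df t) (pf t) (hpS t).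
  exact: represented_laplace_eq (df _) dg (pf _) qg.
(* Capped at 2 because the remainder in the first-order expansions is only quadratic at 0. *)
pose a := Num.min alpha 2.
have a1 : 1 < a by rewrite lt_min halpha ltr1n.
have a12 : 1 <= a <= 2 by rewrite (ltW a1) ge_min lexx orbT.
have aal : a <= alpha by rewrite ge_min lexx.
have mean0 : (\int[lebesgue_measure]_x (x * f 0%N x)%:E = w%:E)%E.
  rewrite -hmean (represented_moment (f 0%N))//.
  apply: eq_integral => y _; have [_ _ fneg _] := df 0%N.
  have [y0|y0] := leP y 0; first by rewrite fneg// !mulr0.
  by rewrite powRr1// ltW.
rewrite (represented_moment (f 0%N))// in hmom.
have [K [K0 HK]] := laplace_taylor1_bound _ _ _ _ (df 0%N) a12 aal hmom mean0.
(* Both transforms share the expansion 1 - w s, the first because the mean is w; the constant adds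
   the two error constants. *)
have dist0 s : 0 <= s ->
    `|laplace (f 0%N) s - limit_laplace w s| <= (K + 2 * w `^ a) * s `^ a.
  move=> s0; have := HK s s0; have := limit_laplace_taylor1_bound a w s a12 hw s0.
  move=> B1 B2; rewrite mulrDl.
  have -> : laplace (f 0%N) s - limit_laplace w s =
    (laplace (f 0%N) s - 1 + w * s) - (limit_laplace w s - 1 + w * s) by ring.
  by apply: (le_trans (ler_normB _ _)); exact: lerD.
have D0 : 0 <= K + 2 * w `^ a by rewrite addr_ge0// mulr_ge0// powR_ge0.
have dps := pdensity_pstar w hw.
have cvgL s : 0 <= s -> laplace (f t) s @[t --> \oo] --> laplace (pstar w) s.
  move=> s0; rewrite laplace_pstar//.
  exact: laplace_cvg _ _ _ _ df a1 hw D0 step dist0 s s0.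
rewrite (eq_cvg _ _ (fun t => represented_primitive0 (f t) (p t) x (df t) (pf t))).
rewrite /primitive0 cdfE//.
(* At x = 0 every distribution function vanishes, a single point being null. *)
move: hx; rewrite le_eqVlt => /predU1P[<-|x0].
  have cdf0 k : cdf k 0 = 0 :> R by rewrite /cdf set_itv1 Rintegral_set1.
  by rewrite (eq_cvg _ _ (fun t => congr1 EFin (cdf0 (f t)))) cdf0; exact: cvg_cst.
apply: cvg_EFin; first exact: nearW.
exact: laplace_continuity.
Qed.
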